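(* Let $A=\begin{pmatrix}1&2\\0&1\end{pmatrix}$ and $B=\begin{pmatrix}1&0\\-2&1\end{pmatrix}$. For an integer $k>0$, let $p_k$ be the polynomial in $2k$ variables with integer coefficients such that $$p_k(m_1,n_1,\dots,m_k,n_k)=\operatorname{tr}\left(A^{m_1}B^{n_1}\cdots A^{m_k}B^{n_k}\right)$$ for all nonzero integers $m_1,n_1,\dots,m_k,n_k$. For a sequence of signs $\sigma:\{1,\dots,2k\}\to\{1,-1\}$ put $$p_k^{\sigma}(x_1,y_1,\dots,x_k,y_k)=p_k\big(\sigma(1)(1+x_1),\sigma(2)(1+y_1),\dots,\sigma(2k-1)(1+x_k),\sigma(2k)(1+y_k)\big).$$ Then for every integer $k>0$ and every $\sigma:\{1,\dots,2k\}\to\{1,-1\}$, all the coefficients of the polynomial $p_k^{\sigma}$ (expanded in monomials in $x_1,y_1,\dots,x_k,y_k$) are of the same sign, that is, the sequence of coefficients of $p_k^\sigma$ has no sign changes.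
   Context: ''All coefficients are of the same sign'' means there are no sign changes among the coefficients: either all coefficients are $\ge 0$ or all are $\le 0$. The polynomial $p_k$ exists and is unique, since $A^{m}=\begin{pmatrix}1&2m\\0&1\end{pmatrix}$ and $B^{n}=\begin{pmatrix}1&0\\-2n&1\end{pmatrix}$ for all integers $m,n$. *)

(* Defs.v *)
From HB Require Import structures.
From mathcomp Require Import all_boot all_order all_algebra.
From mathcomp Require Import mpoly ring.

Set Implicit Arguments.
Unset Strict Implicit.
Unset Printing Implicit Defensive.

Import Order.TTheory GRing.Theory Num.Theory.
Local Open Scope ring_scope.

Definition mx22 (R : Type) (a b c d : R) : 'M[R]_2 :=
  \matrix_(i < 2, j < 2)
    (if val i == 0%N then (if val j == 0%N then a else b)
     else (if val j == 0%N then c else d)).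

Definition matA : 'M[int]_2 := mx22 1 2 0 1.
Definition matB : 'M[int]_2 := mx22 1 0 (-2) 1.

Lemma idx_m_subproof k (i : 'I_k) : (2 * i < 2 * k)%N.
Proof. by rewrite ltn_pmul2l. Qed.

Lemma idx_n_subproof k (i : 'I_k) : ((2 * i).+1 < 2 * k)%N.
Proof. by rewrite !mul2n ltn_Sdouble. Qed.

(* The 2k variables are ordered m_1, n_1, ..., m_k, n_k and indexed from 0:
   m_(i+1) has index 2i and n_(i+1) has index 2i+1. *)
Definition idx_m k (i : 'I_k) : 'I_(2 * k) := Ordinal (idx_m_subproof i).
Definition idx_n k (i : 'I_k) : 'I_(2 * k) := Ordinal (idx_n_subproof i).

(* The powers are integer powers [exprz] in the unit ring 'M[int]_2; matA and
   matB are units (matA_unit, matB_unit), so negative ones are inverses. *)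
Definition word k (v : 'I_(2 * k) -> int) : 'M[int]_2 :=
  \prod_(i < k) (matA ^ v (idx_m i) * matB ^ v (idx_n i)).

Definition is_trace_poly k (p : {mpoly int[2 * k]}) : Prop :=
  forall v : 'I_(2 * k) -> int, (forall i, v i != 0) -> p.@[v] = \tr (word v).

Definition shift_poly k (sigma : 'I_(2 * k) -> int) (p : {mpoly int[2 * k]}) :
    {mpoly int[2 * k]} :=
  p \mPo [tuple (sigma i)%:MP * (1 + 'X_i) | i < 2 * k].

Definition coeffs_same_sign n (q : {mpoly int[n]}) : Prop :=
  (forall m : 'X_{1..n}, 0 <= q@_m) \/ (forall m : 'X_{1..n}, q@_m <= 0).

Lemma mx22M (R : pzSemiRingType) (a b c d a' b' c' d' : R) :
  mx22 a b c d * mx22 a' b' c' d' =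
  mx22 (a * a' + b * c') (a * b' + b * d') (c * a' + d * c') (c * b' + d * d').
Proof.
apply/matrixP=> i j; rewrite !mxE !big_ord_recl big_ord0 !mxE /= addr0.
by case: i => -[|[|i]] //= _; case: j => -[|[|j]] //= _.
Qed.

Lemma mx22_1 (R : pzSemiRingType) : mx22 1 0 0 1 = 1 :> 'M[R]_2.
Proof.
apply/matrixP=> i j; rewrite !mxE.
by case: i => -[|[|i]] //= ?; case: j => -[|[|j]] //= ?.
Qed.

Lemma matA_unit : matA \is a GRing.unit.
Proof.
by apply/unitrP; exists (mx22 1 (-2) 0 1); rewrite !mx22M -mx22_1.
Qed.

Lemma matB_unit : matB \is a GRing.unit.
Proof.
by apply/unitrP; exists (mx22 1 0 2 1); rewrite !mx22M -mx22_1.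
Qed.

Lemma matA_exp (m : int) : matA ^ m = mx22 1 (2 * m) 0 1.
Proof.
have U n : matA ^+ n = mx22 1 (2 * n%:Z) 0 1.
  elim: n => [|n IH]; first by rewrite expr0 mulr0 mx22_1.
  rewrite exprS IH mx22M !mulr1 !mul1r !mulr0 !mul0r !addr0 add0r.
  by congr (mx22 _ _ _ _); rewrite intS; ring.
case: m => n; first exact: U.
rewrite NegzE -exprnN; apply/esym/(mulrI (x := matA ^+ n.+1)).
  by rewrite unitrX // matA_unit.
rewrite divrr ?unitrX ?matA_unit // U.
by rewrite mx22M -mx22_1; congr (mx22 _ _ _ _); ring.
Qed.

Lemma matB_exp (n : int) : matB ^ n = mx22 1 0 (- 2 * n) 1.
Proof.
have U m : matB ^+ m = mx22 1 0 (- 2 * m%:Z) 1.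
  elim: m => [|m IH]; first by rewrite expr0 mulr0 mx22_1.
  rewrite exprS IH mx22M !mulr1 !mul1r !mulr0 !mul0r !addr0 add0r.
  by congr (mx22 _ _ _ _); rewrite intS; ring.
case: n => m; first exact: U.
rewrite NegzE -exprnN; apply/esym/(mulrI (x := matB ^+ m.+1)).
  by rewrite unitrX // matB_unit.
rewrite divrr ?unitrX ?matB_unit // U.
by rewrite mx22M -mx22_1; congr (mx22 _ _ _ _); ring.
Qed.

Lemma trace_poly_exists k : exists p : {mpoly int[2 * k]}, is_trace_poly p.
Proof.
exists (\tr (\prod_(i < k) (mx22 1 (2 * 'X_(idx_m i)) 0 1
                           * mx22 1 0 (- 2 * 'X_(idx_n i)) 1))) => v _.
rewrite /word -(trace_map_mx (meval v)) rmorph_prod /=; congr (\tr _).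
apply: eq_bigr => i _; rewrite rmorphM /= matA_exp matB_exp.
by congr (_ * _); apply/matrixP=> a b; rewrite !mxE;
  case: ifP; case: ifP => _ _;
  rewrite ?rmorphM ?rmorphN ?rmorph1 ?rmorph0 ?rmorph_nat /= ?mevalXU.
Qed.

(* Main.v *)
Require Import Defs.
From HB Require Import structures.
From mathcomp Require Import all_boot all_order all_algebra.
From mathcomp Require Import mpoly ring.

Set Implicit Arguments.
Unset Strict Implicit.
Unset Printing Implicit Defensive.

Import Order.TTheory GRing.Theory Num.Theory.
Local Open Scope ring_scope.

(** Write the shifted exponents as s_j (1 + x_j), with s_j = 1 or -1 and j
running over the 2k letters of the word.  The rotation
S = (0 -1; 1 0) satisfies S^2 = -1 and conjugates upper into lower
unipotents, so that up to sign the word is a product of 2k matrices of one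
kind, [letter s x] = (2(1+x) -s; s 0), those of a continuant recursion
(lemma [mulAB_letter]).

The entry -s spoils positivity, but only in the standard basis.  In that
recursion the vectors (p, q) obey p' = 2(1+x) p - e q, q' = p, once q is
rescaled by the sign of its letter, e being the product of two consecutive
signs.  Both for e = 1 and for e = -1 the cone p >= q >= 0 is preserved:
p' - q' = (1+2x)(p - q) + (1 + 2x - e) q, and 1 + 2x - e is 2x or 2 + 2x.
Expressed on the generators (1, 0), (1, 1) of the cone, each letter is thus a
matrix [transfer e x] all of whose entries have nonnegative coefficients.

The rescaling depends on the sign s_j, but the change of basis after letter j
is the one before letter j + 1, so all of them telescope, and cyclicity of the
trace removes the outer two (lemmas [prod_letter_basis], [tr_prod_letter]).
Hence the trace is an explicit sign times the trace of a product of matrices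
with entries in the semiring of polynomials with nonnegative coefficients.

It remains to know that p is the trace of the generic product, though the
hypothesis only gives its values at tuples of nonzero integers; this is the
vanishing criterion [mpoly_eq0_infinite]. *)

(** * Polynomials vanishing on an infinite grid *)

Lemma poly_eq0_infinite (R : idomainType) (f : nat -> R) (p : {poly R}) :
  injective f -> (forall a, p.[f a] = 0) -> p = 0.
Proof.
move=> finj pf0; apply/eqP/negPn/negP => p0.
have rs0 : all (root p) (map f (iota 0 (size p))).
  by apply/allP => _ /mapP[a _ ->]; rewrite /root pf0.
have := max_poly_roots p0 rs0.
by rewrite size_map size_iota ltnn map_inj_uniq // iota_uniq => /(_ isT).
Qed.

(** Coordinates are released one at a time: a partial evaluation of p, in which
the first j variables take arbitrary values and the others values of f, is
univariate polynomial in each released value, over a domain, with infinitely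
many roots.  Taking the variables themselves as values gives back p. *)
Lemma mpoly_eq0_infinite (R : idomainType) (n : nat) (f : nat -> R)
    (p : {mpoly R[n]}) :
  injective f -> (forall v : 'I_n -> nat, p.@[fun i => f (v i)] = 0) -> p = 0.
Proof.
move=> finj pf0.
pose ev (h : 'I_n -> {mpoly R[n]}) := mmap (@mpolyC n R) h p.
have evE h : ev h = \sum_(m <- msupp p) p@_m *: \prod_i h i ^+ m i.
  by apply: eq_bigr => m _; rewrite mul_mpolyC.
have ev0 j : forall h : 'I_n -> {mpoly R[n]},
    (forall i : 'I_n, (j <= i)%N -> exists a, h i = (f a)%:MP) -> ev h = 0.
  elim: j => [|j IHj] h hf.
    have /fin_all_exists[v hv] : forall i, exists a, h i = (f a)%:MP.
      by move=> i; apply: hf.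
    have -> : ev h = (p.@[fun i => f (v i)])%:MP.
      rewrite evE mevalE rmorph_sum; apply: eq_bigr => m _ /=.
      rewrite mpolyCM mul_mpolyC rmorph_prod; congr (_ *: _).
      by apply: eq_bigr => i _; rewrite hv rmorphXn.
    by rewrite pf0 mpolyC0.
  (* Free the coordinate of index j: as a function of its value, the evaluation
     is a univariate polynomial q over the domain of polynomials. *)
  have [jn | nj] := ltnP j n; last first.
    by apply: IHj => i ji; have := leq_ltn_trans (leq_trans nj ji) (ltn_ord i);
       rewrite ltnn.
  pose hX i : {poly {mpoly R[n]}} := if i == Ordinal jn then 'X else (h i)%:P.
  pose q := \sum_(m <- msupp p) (p@_m)%:MP%:P * \prod_i hX i ^+ m i.
  pose hz z i := if i == Ordinal jn then z else h i.
  have qE z : q.[z] = ev (hz z).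
    rewrite evE horner_sum; apply: eq_bigr => m _.
    rewrite hornerM hornerC mul_mpolyC horner_prod; congr (_ *: _).
    by apply: eq_bigr => i _; rewrite horner_exp /hX /hz; case: ifP => _;
       rewrite ?hornerX ?hornerC.
  have q0 : q = 0.
    apply: (@poly_eq0_infinite _ (fun a => (f a)%:MP)) => [a b|a].
      by move/(can_inj (@mpolyCK _ _))/finj.
    rewrite qE; apply: IHj => i ji; rewrite /hz.
    case: ifP => [_|/negbT ij]; first by exists a.
    apply: hf; rewrite ltn_neqAle ji andbT.
    by apply: contra ij => /eqP ij; apply/eqP/val_inj.
  have -> : ev h = q.[h (Ordinal jn)].
    by rewrite qE !evE; apply: eq_bigr => m _; congr (_ *: _);
       apply: eq_bigr => i _; rewrite /hz; case: eqP => // ->.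
  by rewrite q0 horner0.
rewrite -[LHS]comp_mpoly_id; apply: (ev0 n) => i.
by rewrite leqNgt ltn_ord.
Qed.

(** * Letters and their transfer matrices *)

(** This is s u S, where u = (1 2s(1+x); 0 1) is the unipotent with exponent
s (1 + x) and S = (0 -1; 1 0); the factor s makes the corner entry free of
signs. *)
Definition letter {R : comNzRingType} (s x : R) := mx22 (2 * (1 + x)) (- s) s 0.

(** The columns are the generators (1, 0) and (1, 1) of the cone
p >= q >= 0, with second coordinates rescaled by s. *)
Definition basis {R : comNzRingType} (s : R) := mx22 1 1 0 s.

(** The letter read in cone coordinates; e stands for the product of the signs
of the letter and of its successor. *)
Definition transfer {R : comNzRingType} (e x : R) :=
  mx22 (1 + 2 * x) (1 + 2 * x - e) 1 1.

(** With u, v the upper unipotents of exponents s (1 + x) and t (1 + y), the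
left side is u (S v S^-1) = - (u S) (v S), because S^-1 = - S. *)
Lemma mulAB_letter (R : comNzRingType) (s t x y : R) : s * s = 1 -> t * t = 1 ->
  mx22 1 (2 * (s * (1 + x))) 0 1 * mx22 1 0 (- 2 * (t * (1 + y))) 1 =
  - (s * t) *: (letter s x * letter t y).
Proof.
move=> ss tt.
have scale_mx22 a b c d (u : R) : u *: mx22 a b c d =
    mx22 (u * a) (u * b) (u * c) (u * d).
  by apply/matrixP => i j; rewrite !mxE; do 2!case: ifP.
rewrite !mx22M scale_mx22; congr mx22.
- have -> : 1 = (s * s) * (t * t) :> R by rewrite ss tt mulr1.
  ring: ss tt.
- ring: ss tt.
- ring: ss tt.
- ring: ss tt.
Qed.

Lemma letter_basis (R : comNzRingType) (s t x : R) :
  letter s x * basis t = basis s * transfer (s * t) x.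
Proof. by rewrite !mx22M; congr mx22; ring. Qed.

(** Each application of [letter_basis] turns the basis of letter j + 1 into the
basis of letter j, whence the telescoping. *)
Lemma prod_letter_basis (R : comNzRingType) (s x : nat -> R) n :
  (\prod_(0 <= j < n) letter (s j) (x j)) * basis (s n) =
  basis (s 0%N) * \prod_(0 <= j < n) transfer (s j * s j.+1) (x j).
Proof.
elim: n => [|n IHn]; first by rewrite !big_nil mul1r mulr1.
by rewrite !big_nat_recr //= -mulrA letter_basis mulrA IHn mulrA.
Qed.

Lemma basis_inv (R : comNzRingType) (s : R) :
  s * s = 1 -> basis s * mx22 1 (- s) 0 s = 1.
Proof. by move=> ss; rewrite mx22M -mx22_1; congr mx22; ring: ss. Qed.

(** Since the signs close up cyclically, the two outer bases are equal and the
products are conjugate. *)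
Lemma tr_prod_letter (R : comNzRingType) (s x : nat -> R) n :
  s 0%N * s 0%N = 1 -> s n = s 0%N ->
  \tr (\prod_(0 <= j < n) letter (s j) (x j)) =
  \tr (\prod_(0 <= j < n) transfer (s j * s j.+1) (x j)).
Proof.
move=> ss sn; set L := \prod_(_ <= _ < _) _; set T := \prod_(_ <= _ < _) _.
have LP : L * basis (s 0%N) = basis (s 0%N) * T.
  by rewrite -{1}sn prod_letter_basis.
rewrite -[L]mulr1 -(basis_inv ss) mulrA LP -mulrA.
rewrite [LHS]mxtrace_mulC -mulmxA (mulmx1C (basis_inv ss)).
by rewrite mulmx1.
Qed.

Lemma tr_word_letter (R : comNzRingType) (s x : nat -> R) k :
  (forall j, s j * s j = 1) -> s (2 * k)%N = s 0%N ->
  \tr (\prod_(i < k)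
        (mx22 1 (2 * (s (2 * i)%N * (1 + x (2 * i)%N))) 0 1 *
         mx22 1 0 (- 2 * (s (2 * i).+1 * (1 + x (2 * i).+1))) 1)) =
  \prod_(i < k) (- (s (2 * i)%N * s (2 * i).+1)) *
  \tr (\prod_(0 <= j < 2 * k) transfer (s j * s j.+1) (x j)).
Proof.
move=> ss sk; rewrite -tr_prod_letter // -mxtraceZ; congr (\tr _).
elim: {sk}k => [|k IHk]; first by rewrite !big_ord0 big_nil scale1r.
rewrite !big_ord_recr /= IHk mulAB_letter // mulnS !add2n !big_nat_recr //=.
by rewrite -scalerAl -scalerAr scalerA mulrA.
Qed.

(** * Signs of the coefficients *)

Lemma signM (a b : int) :
  a = 1 \/ a = -1 -> b = 1 \/ b = -1 -> a * b = 1 \/ a * b = -1.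
Proof. by case=> ->; case=> ->; rewrite ?mulrNN ?mulr1 ?mul1r; auto. Qed.

(** Here it matters that exponents are shifted by 1: the constant term 1 of
1 + 2x absorbs - e when e = 1. *)
Lemma transfer_nonneg n (e : int) (i : 'I_n) : e = 1 \/ e = -1 ->
  transfer (e%:MP : {mpoly int[n]}) 'X_i
    \is a mxOver (mpolyOver n (@Num.Def.nneg_num_pred int)).
Proof.
move=> he.
have X2 : 2 * 'X_i \is a mpolyOver n (@Num.Def.nneg_num_pred int).
  by rewrite rpredM ?rpred_nat ?mpolyOverX.
have Xe : 1 + 2 * 'X_i - e%:MP \is a mpolyOver n (@Num.Def.nneg_num_pred int).
  case: he => ->; rewrite ?mpolyCN mpolyC1; first by rewrite addrAC subrr add0r.
  by rewrite opprK !rpredD ?rpred1.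
apply/mxOverP => a b; rewrite mxE; case: ifP => _; case: ifP => _ //;
  by rewrite ?rpredD ?rpred1.
Qed.

Theorem theorem1p1 (k : nat) (hk : (0 < k)%N)
    (p : {mpoly int[2 * k]}) (hp : is_trace_poly p)
    (sigma : 'I_(2 * k) -> int)
    (hsigma : forall i, sigma i = 1 \/ sigma i = -1) :
  coeffs_same_sign (shift_poly sigma p).
Proof.
have n0 : (0 < 2 * k)%N by rewrite muln_gt0.
pose M (w : 'I_(2 * k) -> {mpoly int[2 * k]}) :=
  \prod_(i < k) (mx22 1 (2 * w (idx_m i)) 0 1 * mx22 1 0 (- 2 * w (idx_n i)) 1).
have mapM (T : comNzRingType) (g : {rmorphism {mpoly int[2 * k]} -> T}) w :
    g (\tr (M w)) = \tr (\prod_(i < k) (mx22 1 (2 * g (w (idx_m i))) 0 1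
                           * mx22 1 0 (- 2 * g (w (idx_n i))) 1)).
  rewrite -trace_map_mx rmorph_prod; congr (\tr _); apply: eq_bigr => i _.
  rewrite rmorphM /=; congr (_ * _); apply/matrixP=> a b; rewrite !mxE;
    by case: ifP; case: ifP => _ _;
    rewrite ?rmorphM ?rmorphN ?rmorph1 ?rmorph0 ?rmorph_nat.
have pE : p = \tr (M (fun i => 'X_i)).
  apply/eqP; rewrite -subr_eq0; apply/eqP.
  (* Positive integers are enough to determine p. *)
  apply: (@mpoly_eq0_infinite _ _ (fun a => a.+1%:Z)) => [a b [] //|v].
  rewrite mevalB hp // mapM /word; apply/eqP; rewrite subr_eq0; apply/eqP.
  congr (\tr _); apply: eq_bigr => i _.
  by rewrite /= matA_exp matB_exp !mevalXU.
(* Positions are read modulo 2k, so that the last letter is followed by the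
   first one. *)
pose ix j := Ordinal (ltn_pmod j n0).
pose s j : {mpoly int[2 * k]} := (sigma (ix j))%:MP.
pose x j : {mpoly int[2 * k]} := 'X_(ix j).
have ixE (i : 'I_(2 * k)) : ix i = i by apply/val_inj; rewrite /= modn_small.
have ss j : s j * s j = 1.
  rewrite -mpolyCM; case: (hsigma (ix j)) => ->;
    by rewrite ?mulrNN mulr1 mpolyC1.
have shiftE : shift_poly sigma p =
    \prod_(i < k) (- (s (2 * i)%N * s (2 * i).+1)) *
    \tr (\prod_(0 <= j < 2 * k) transfer (s j * s j.+1) (x j)).
  rewrite -tr_word_letter //; last first.
    by congr ((sigma _)%:MP); apply: val_inj; rewrite /= modnn mod0n.
  rewrite pE /shift_poly mapM; congr (\tr _); apply: eq_bigr => i _.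
  rewrite /= !comp_mpolyXU -!tnth_nth !tnth_mktuple.
  by rewrite -[idx_m i]ixE -[idx_n i]ixE.
have Tge0 : \tr (\prod_(0 <= j < 2 * k) transfer (s j * s j.+1) (x j))
    \is a mpolyOver (2 * k) (@Num.Def.nneg_num_pred int).
  apply: rpred_sum => i _; apply/mxOverP.
  apply: (big_ind (fun N => N \is a mxOver (mpolyOver _ _))).
  - by apply/mxOverP => a b; rewrite mxE rpred_nat.
  - move=> N N' /mxOverP N0 /mxOverP N0'; apply/mxOverP => a b.
    by rewrite mxE rpred_sum // => c _; rewrite rpredM.
  move=> j _; rewrite -mpolyCM; apply: transfer_nonneg.
  exact: signM.
pose c : int := \prod_(i < k) (- (sigma (idx_m i) * sigma (idx_n i))).
have c1 : c = 1 \/ c = -1.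
  apply: (big_ind (fun a : int => a = 1 \/ a = -1)); first by left.
    exact: signM.
  by move=> i _; rewrite -[- (_ * _)]mulN1r; apply: signM; [right|apply: signM].
have cE : \prod_(i < k) (- (s (2 * i)%N * s (2 * i).+1)) = c%:MP.
  rewrite rmorph_prod; apply: eq_bigr => i _.
  by rewrite /= mpolyCN mpolyCM -[idx_m i]ixE -[idx_n i]ixE.
rewrite shiftE cE; move/mpolyOverP: Tge0 => Tge0.
case: c1 => ->; [left|right] => m; have := Tge0 m; rewrite nnegrE mcoeffCM.
  by rewrite mul1r.
by rewrite mulN1r oppr_le0.
Qed.
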